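(* Let $G,H$ be simple graphs, each of even order at least four. Then $G$ and $H$ are both PH if and only if every pairing of $G\square H$ has a Hamiltonian completion in $G\square H$ with prismatic support.
   Context: Graphs are finite and simple. For a graph $G$, let $K_G$ denote the complete graph on the vertex set $V(G)$. A perfect matching of $K_G$ is called a pairing of $G$ (its edges need not belong to $G$). A Hamiltonian completion of a pairing $M$ in $G$ is a perfect matching $N\subseteq E(G)$ of $G$, disjoint from $M$, such that $M\cup N$ is (the edge set of) a Hamiltonian cycle of $K_G$. A graph $G$ of even order at least four is PH (has the Pairing-Hamiltonian property) if every pairing of $G$ has a Hamiltonian completion in $G$. The Cartesian product $G\square H$ has vertex set $V(G)\times V(H)$, where $(u,x)$ and $(v,y)$ are adjacent precisely when $u=v$ and $xy\in E(H)$, or $x=y$ and $uv\in E(G)$. In a Cartesian product, a perfect matching $F$ of a graph $G$ is identified with the spanning graph $(V(G),F)$; so $F\square H$ means $(V(G),F)\square H$, and similarly for a perfect matching of $H$ in the second factor. Prismatic support: let $G,H$ be graphs of even order at least four and let $M$ be a pairing of $G\square H$ (i.e. a perfect matching of the complete graph on $V(G)\times V(H)$). A Hamiltonian completion $N$ of $M$ in $G\square H$ has prismatic support if at least one of the following holds: (i) $N\subseteq E(F_G\square H)$ for some perfect matching $F_G\subseteq E(G)$ of $G$; (ii) $N\subseteq E(G\square F_H)$ for some perfect matching $F_H\subseteq E(H)$ of $H$. Which of (i), (ii) holds, and the corresponding perfect matching, may depend on $M$. *)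

(* Defs.v *)
From mathcomp Require Import all_boot.

Set Implicit Arguments.
Unset Strict Implicit.
Unset Printing Implicit Defensive.

Record sgraph := SGraph {
  vertex :> finType;
  adj : rel vertex;
  adj_sym : symmetric adj;
  adj_irr : irreflexive adj
}.

Definition edges (G : sgraph) : {set {set G}} :=
  [set [set x; y] | x in G, y in G & adj x y].

Lemma complete_sym (T : finType) : symmetric (fun x y : T => x != y).
Proof. by move=> x y; rewrite eq_sym. Qed.

Lemma complete_irr (T : finType) : irreflexive (fun x y : T => x != y).
Proof. by move=> x; rewrite eqxx. Qed.

Definition complete (T : finType) : sgraph :=
  SGraph (@complete_sym T) (@complete_irr T).

Definition spanning_adj (T : finType) (F : {set {set T}}) : rel T :=
  fun x y => (x != y) && ([set x; y] \in F).

Lemma spanning_sym (T : finType) (F : {set {set T}}) :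
  symmetric (spanning_adj F).
Proof. by move=> x y; rewrite /spanning_adj eq_sym setUC. Qed.

Lemma spanning_irr (T : finType) (F : {set {set T}}) :
  irreflexive (spanning_adj F).
Proof. by move=> x; rewrite /spanning_adj eqxx. Qed.

(* The guard [x != y] in [spanning_adj] only matters if F contains
   singletons, which never happens when F consists of edges. *)
Definition spanning (T : finType) (F : {set {set T}}) : sgraph :=
  SGraph (spanning_sym F) (spanning_irr F).

Definition cart_adj (G H : sgraph) : rel (G * H) :=
  fun p q => (p.1 == q.1) && adj p.2 q.2 || (p.2 == q.2) && adj p.1 q.1.

Lemma cart_sym (G H : sgraph) : symmetric (@cart_adj G H).
Proof.
move=> p q; rewrite /cart_adj (eq_sym p.1) (eq_sym p.2).
by rewrite (adj_sym p.1) (adj_sym p.2).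
Qed.

Lemma cart_irr (G H : sgraph) : irreflexive (@cart_adj G H).
Proof. by move=> p; rewrite /cart_adj !adj_irr !andbF. Qed.

Definition cart (G H : sgraph) : sgraph :=
  SGraph (@cart_sym G H) (@cart_irr G H).

Definition perfect_matching (G : sgraph) (F : {set {set G}}) : Prop :=
  F \subset edges G /\ partition F [set: G].

(* C is the edge set of a Hamiltonian cycle of G, the cycle being listed by c. *)
Definition hamiltonian_cycle (G : sgraph) (C : {set {set G}}) : Prop :=
  exists c : seq G,
    [/\ 2 < size c, ucycle (@adj G) c, forall x : G, x \in c
      & C = [set [set x; next c x] | x : G]].

Definition pairing (G : sgraph) (M : {set {set G}}) : Prop :=
  @perfect_matching (complete G) M.

Definition hamiltonian_completion (G : sgraph) (M N : {set {set G}}) : Prop :=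
  [/\ perfect_matching N, [disjoint M & N]
    & @hamiltonian_cycle (complete G) (M :|: N)].

Definition PH (G : sgraph) : Prop :=
  [/\ ~~ odd #|G|, 4 <= #|G|
    & forall M : {set {set G}}, pairing M ->
        exists N : {set {set G}}, hamiltonian_completion M N].

Definition prismatic_support (G H : sgraph) (N : {set {set cart G H}}) : Prop :=
  (exists2 F : {set {set G}}, perfect_matching F
     & N \subset edges (cart (spanning F) H))
  \/ (exists2 F : {set {set H}}, perfect_matching F
     & N \subset edges (cart G (spanning F))).

(* Main.v *)
Require Import Defs.
From mathcomp Require Import all_boot.

(** A perfect matching is handled as a fixed-point-free involution, and two
perfect matchings [f], [n] of a set of more than two vertices form a
Hamiltonian cycle exactly when their union is connected
([hamiltonian_completionP]). So a Hamiltonian completion is a matching that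
makes the given pairing connected, and the whole argument is about
connectivity.

Let [M] be a pairing of [G □ H]. Declare two vertices of [H] equivalent when
edges of [M] link, step by step, the layer of one to the layer of the other;
this partitions [V(H)], and [V(G)] is partitioned in the same way. For a class
[A] of [V(G)] and a class [B] of [V(H)], the block [A × B] is a union of edges
of [M], so [|A| * |B|] is even ([even_block]). Hence all the classes of [V(H)]
are even, or all those of [V(G)] are. By symmetry take the former. Pair the
vertices of [H] inside the classes; since [H] is PH, some perfect matching [F]
of [H] completes that pairing to a Hamiltonian cycle, so that the classes
together with [F] connect [V(H)]. In other words the prisms [G □ {h, F h}] are
linked to one another by [M], and it remains to complete [M] inside these
prisms ([product_completion]). Two facts achieve that.

- [prism_PH]: a prism over a PH graph is PH.
- [gluing]: if the vertex set is partitioned into classes each of which is PH,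
  and [M] links all the classes, then [M] has a completion whose edges stay
  inside the classes. Classes are removed one by one, each time one whose
  removal leaves the others linked; inside it, the endpoints of outgoing edges
  of [M] are temporarily paired, and the alternating paths thus created are
  replaced by edges of a pairing of the rest ([absorb_class]).

The splitting of alternating cycles is controlled by a parity argument
([even_closed]): a set closed under a fixed-point-free involution is even.

Conversely, given a pairing [f] of [G], take its copies in all the layers of
[G □ H] as [M]. No edge of [M] changes the coordinate in [H], so a completion
supported in [G □ F_H] would leave the cycle inside one prism
([lift_not_vertical]). The completion is thus supported in some [F_G □ H], and
projecting the cycle to [G] shows that [F_G] completes [f]
([lift_horizontal]). *)

Set Implicit Arguments.
Unset Strict Implicit.
Unset Printing Implicit Defensive.

(** * Matchings as involutions *)

(** Being the identity off [A] makes [f] a total involution, so that the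
alternating relation below is symmetric on all of [T]. *)
Definition matches (T : finType) (A : {set T}) (f : T -> T) : Prop :=
  involutive f /\ forall x, (f x != x) = (x \in A).

Definition alt_rel (T : finType) (f n : T -> T) : rel T :=
  fun x y => (f x == y) || (n x == y).

Definition completes (T : finType) (E : rel T) (A : {set T}) (f n : T -> T) :=
  [/\ matches A n, {in A, forall x, E x (n x)}
    & {in A &, forall x y, connect (alt_rel f n) x y}].

(** The evenness is there because, without it, an odd [A] would qualify for lack
of matchings. *)
Definition PHon (T : finType) (E : rel T) (A : {set T}) : Prop :=
  ~~ odd #|A| /\ forall f, matches A f -> exists n, completes E A f n.

(** * Connectivity *)

Section Connect.
Variables (T : finType).
Implicit Types (e : rel T) (f n : T -> T).

Lemma connect_closed e (P : T -> Prop) x y :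
  (forall u v, e u v -> P u -> P v) -> connect e x y -> P x -> P y.
Proof.
move=> He /connectP[s]; elim: s x => [x _ -> //|z s IH x /= /andP[exz] pz yE Px].
by apply: (IH z) => //; apply: (He x).
Qed.

Lemma connect_img (T' : finType) e (e' : rel T') (h : T -> T') :
  (forall x y, e x y -> connect e' (h x) (h y)) ->
  forall x y, connect e x y -> connect e' (h x) (h y).
Proof.
move=> He x y cxy; apply: (@connect_closed e (fun z => connect e' (h x) (h z)) x y) => //.
by move=> u v /He/[swap]; apply: connect_trans.
Qed.

Lemma alt_sym f n : involutive f -> involutive n -> connect_sym (alt_rel f n).
Proof.
move=> fK nK; apply: sym_connect_sym => x y; rewrite /alt_rel.
by rewrite -(inj_eq (inv_inj fK)) -(inj_eq (inv_inj nK) (n x)) fK nK !(eq_sym x).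
Qed.

Lemma alt1 f n x : connect (alt_rel f n) x (f x).
Proof. by apply: connect1; rewrite /alt_rel eqxx. Qed.

Lemma alt2 f n x : connect (alt_rel f n) x (n x).
Proof. by apply: connect1; rewrite /alt_rel eqxx orbT. Qed.

(** A largest proper connected subset of [S] misses a single element: otherwise
adding a neighbour would give a larger one. *)
Lemma exists_noncut e (S : {set T}) :
  symmetric e -> 1 < #|S| -> {in S &, forall x y, connect e x y} ->
  (forall x y, e x y -> x \in S -> y \in S) ->
  exists2 c, c \in S & {in S :\ c &, forall x y,
    connect (fun u v => [&& u \in S :\ c, v \in S :\ c & e u v]) x y}.
Proof.
move=> e_sym S_gt1 connS closS.
pose res (X : {set T}) : rel T := fun u v => [&& u \in X, v \in X & e u v].
pose good (X : {set T}) := [&& X != set0, X \proper S &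
  [forall x in X, forall y in X, connect (res X) x y]].
have /card_gt0P[x0 x0S] : 0 < #|S| by apply: ltnW.
have good0 : good [set x0].
  apply/and3P; split; first by apply/set0Pn; exists x0; rewrite inE.
    rewrite properEcard sub1set x0S cards1 //.
  by apply/forall_inP => x /set1P->; apply/forall_inP => y /set1P->; apply: connect0.
case: (@arg_maxnP _ [set x0] good (fun X => #|X|) good0) => X.
case/and3P=> /set0Pn[x xX] XS /forall_inP connX maxX.
have [v /setDP[vS vX] [u uX euv]] : exists2 v, v \in S :\: X & exists2 u, u \in X & e u v.
  have /properP[/subsetP sXS [w wS wX]] := XS.
  case: (pickP [pred p : T * T | [&& p.1 \in X, p.2 \in S :\: X & e p.1 p.2]]).
    by case=> u v /= /and3P[uX vSX euv]; exists v => //; exists u.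
  move=> none; case/negP: wX.
  apply: (@connect_closed e (fun z => z \in X) x w _ _ xX); last exact: connS (sXS _ xX) wS.
  move=> a b eab aX; apply: contraFT (none (a, b)) => bX /=.
  by rewrite aX inE bX eab (closS a) // sXS.
have uv: u != v by apply: contraNneq vX => <-.
have symX Y : connect_sym (res Y).
  apply: sym_connect_sym => a b; rewrite /res e_sym; by case: (a \in Y); case: (b \in Y).
have SE : S = v |: X.
  apply/eqP; apply: contraT => SvX.
  have: good (v |: X).
    have toU z : z \in v |: X -> connect (res (v |: X)) u z.
      case/setU1P=> [->|zX]; first by apply: connect1; rewrite /res !inE uX eqxx euv orbT.
      apply: (@connect_sub _ (res X)); last exact: (forall_inP (connX u uX)).
      move=> a b /and3P[aX bX eab]; apply: connect1; by rewrite /res !inE aX bX eab !orbT.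
    apply/and3P; split; first by apply/set0Pn; exists v; rewrite !inE eqxx.
      rewrite properEneq eq_sym SvX subUset sub1set vS /=; exact: proper_sub.
    apply/forall_inP => a /toU ua; apply/forall_inP => b /toU.
    by apply: connect_trans; rewrite symX.
  by move/maxX; rewrite /= cardsU1 vX add1n ltnn.
have SX : S :\ v = X by rewrite SE setU1K.
exists v; first by [].
by rewrite SX => a b aX; apply: (forall_inP (connX a aX)).
Qed.

End Connect.

(** * Parity *)

Section Matching.
Variable T : finType.
Implicit Types (A B : {set T}) (f n : T -> T).

Lemma matchesK A f : matches A f -> involutive f.
Proof. by case. Qed.

Lemma matches_neq A f x : matches A f -> x \in A -> f x != x.
Proof. by case=> _ ->. Qed.

Lemma matches_out A f x : matches A f -> x \notin A -> f x = x.
Proof. by case=> _ <- /negPn/eqP. Qed.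

Lemma matches_in A f x : matches A f -> (f x \in A) = (x \in A).
Proof. by case=> fK suppE; rewrite -!suppE fK eq_sym. Qed.

Lemma even_closed f B : involutive f -> {in B, forall x, f x != x} ->
  {in B, forall x, f x \in B} -> ~~ odd #|B|.
Proof.
move=> fK; have [m] := ubnP #|B|; elim: m B => // m IH B ltBm fB clB.
have [->|[x xB]] := set_0Vmem B; first by rewrite cards0.
have fxB : f x \in B :\ x by rewrite !inE fB ?clB.
rewrite (cardsD1 x) xB (cardsD1 (f x)) fxB /= negbK; apply: IH.
- move: ltBm; rewrite (cardsD1 x) xB (cardsD1 (f x)) fxB !add1n ltnS; exact: ltnW.
- by move=> y; rewrite !inE => /and3P[_ _]; apply: fB.
move=> y; rewrite !inE => /and3P[yfx yx yB]; rewrite clB // andbT.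
by rewrite (inj_eq (inv_inj fK)) yx (can2_eq fK fK) yfx.
Qed.

(** A constant [l] pairs up any even set; roots of components as labels confine the
pairs to the components of a graph. *)
Lemma exists_matching (L : eqType) (l : T -> L) A :
  {in A, forall x, ~~ odd #|[set y in A | l y == l x]|} ->
  exists p, matches A p /\ forall x, l (p x) = l x.
Proof.
have [m] := ubnP #|A|; elim: m A => // m IH A ltAm evA.
have [->|[x xA]] := set_0Vmem A.
  by exists id; split=> //; split=> // x; rewrite inE eqxx.
have [y yA /eqP lyx] : exists2 y, y \in A :\ x & l y == l x.
  have := evA x xA; rewrite (cardsD1 x) !inE xA eqxx /= negbK.
  case: (set_0Vmem ([set y in A | l y == l x] :\ x)) => [->|[y]]; first by rewrite cards0.
  by rewrite !inE => /and3P[yx yA lyx] _; exists y; rewrite ?inE ?yx.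
have /setD1P[yx yA'] := yA.
have [||p [[pK suppE] lp]] := IH (A :\ x :\ y).
- move: ltAm; rewrite (cardsD1 x) xA (cardsD1 y) yA !add1n ltnS; exact: ltnW.
- move=> z; rewrite !inE => /and3P[zy zx zA].
  have := evA z zA; have [lzx|nlzx] := eqVneq (l x) (l z).
    rewrite (cardsD1 x) (cardsD1 y) !inE xA yA' yx lyx lzx eqxx /= negbK.
    by congr (~~ odd #|pred_of_set _|); apply/setP => w; rewrite !inE !andbA.
  congr (~~ odd #|pred_of_set _|); apply/setP => w; rewrite !inE.
  have [->|] := eqVneq w x; first by rewrite (negPf nlzx) !andbF.
  by have [->|] := eqVneq w y; first by rewrite lyx (negPf nlzx) !andbF.
have px : p x = x by apply/eqP/negPn; rewrite suppE !inE eqxx andbF.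
have py : p y = y by apply/eqP/negPn; rewrite suppE !inE eqxx.
exists (fun z => if z == x then y else if z == y then x else p z); split; last first.
  by move=> z; case: eqP => [->//|_]; case: eqP => [->//|_].
split=> z.
  have [->|zx] := eqVneq z x; first by rewrite (negPf yx) eqxx.
  have [->|zy] := eqVneq z y; first by rewrite eqxx.
  by rewrite -{1}px -{2}py !(inj_eq (inv_inj pK)) (negPf zx) (negPf zy).
have [->|zx] := eqVneq z x; first by rewrite yx xA.
have [->|zy] := eqVneq z y; first by rewrite eq_sym yx yA'.
by rewrite suppE !inE zx zy.
Qed.

End Matching.
(** * Gluing completions along a partition *)

Definition quot_rel (T K : finType) (k : T -> K) (f : T -> T) : rel K :=
  fun c d => [exists x, (k x == c) && (k (f x) == d)].

Lemma quot_sym (T K : finType) (k : T -> K) f :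
  involutive f -> symmetric (quot_rel k f).
Proof.
move=> fK c d; apply/existsP/existsP => -[x /andP[kx kfx]];
  by exists (f x); rewrite fK kx kfx.
Qed.

Lemma quot1 (T K : finType) (k : T -> K) f x : quot_rel k f (k x) (k (f x)).
Proof. by apply/existsP; exists x; rewrite !eqxx. Qed.

(** Completing a class [C] reduces the problem to the complement of [C]. The
endpoints [D] in [C] of the edges of [f] leaving [C] are even in number; pairing
them arbitrarily extends [f] to a matching of [C], which has a completion [n0].
Forgetting the arbitrary pairs, let [R] be the graph of [f] and [n0] inside [C].
Each component of [R] is closed under [n0], and off [D] under [f], so it meets
[D] in an even number of points, and it does meet [D] because the cycle through
[C] does. Pairing [D] by some [p] inside the components, the reduced matching
[f'] joins [u] to [f (p (f u))] when [f u] lies in [C]: its ends are joined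
through [C] by [f] and [n0]. *)
Lemma absorb_class (T : finType) (E : rel T) (C A : {set T}) (f : T -> T) :
  PHon E C -> matches A f -> C \subset A ->
  (exists2 d, d \in C & f d \notin C) ->
  exists f', [/\ matches (A :\: C) f',
    forall x, x \notin C -> f x \notin C -> f' x = f x
    & (exists n, completes E (A :\: C) f' n) -> exists n, completes E A f n].
Proof.
case=> evC phC mf sCA [d0 d0C fd0C]; have [fK suppf] := mf.
pose D := [set x in C | f x \notin C].
have fb x : x \in C -> f x != x by move=> xC; rewrite suppf (subsetP sCA).
have DC x : x \in D -> x \in C by rewrite inE => /andP[].
have CD x : x \in C -> x \notin D -> f x \in C.
  by move=> xC; rewrite inE xC negbK.
have fD x : x \in C -> f x \in C -> f x \notin D.
  by move=> xC fxC; rewrite inE fxC fK xC.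
(* In an f-closed part of C only the points of D can be odd in number. *)
have even_part (B : {set T}) : B \subset C -> {in B :\: D, forall x, f x \in B} -> ~~ odd #|B| ->
    ~~ odd #|D :&: B|.
  move=> sBC clB; rewrite setIC -(cardsID D) oddD.
  suff /negbTE-> : ~~ odd #|B :\: D| by rewrite addbF.
  apply: (even_closed fK) => x /[dup] xBD /setDP[/(subsetP sBC)xC xD]; first exact: fb.
  by rewrite inE clB // andbT fD // CD.
have evD : ~~ odd #|D|.
  have := even_part C (subxx _); rewrite (setIidPl _); last by apply/subsetP.
  by apply=> // x /setDP[xC]; apply: CD.
have [|p0 [mp0 _]] := @exists_matching T _ (fun=> tt) D.
  by move=> x _; congr (~~ odd #|pred_of_set _|): evD; apply/setP => y; rewrite inE eqxx andbT.
(* f inside C, completed by the arbitrary pairing of D *)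
pose mc x := if x \in C then if x \in D then p0 x else f x else x.
have mmc : matches C mc.
  split=> x; rewrite /mc; last first.
    case xC: (x \in C); last by rewrite eqxx.
    by case xD: (x \in D); [rewrite (matches_neq mp0 xD) | rewrite fb].
  case xC: (x \in C); last by rewrite xC.
  case xD: (x \in D); last by rewrite CD ?xD // (negPf (fD _ _ _)) ?CD ?xD.
  have pD : p0 x \in D by rewrite (matches_in _ mp0).
  by rewrite pD (DC _ pD) (matchesK mp0).
have [n0 [mn0 En0 conn0]] := phC mc mmc.
pose R : rel T := fun x y => (n0 x == y) || [&& x \in C, x \notin D & f x == y].
have Rsym : connect_sym R.
  apply: sym_connect_sym.
  have imp x y : R x y -> R y x.
    case/orP=> [/eqP<-|/and3P[xC xD /eqP<-]]; first by rewrite /R (matchesK mn0) eqxx.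
    by rewrite /R fK CD // fD ?CD ?eqxx ?orbT.
  by move=> x y; apply/idP/idP; apply: imp.
have RC x y : connect R x y -> x \in C -> y \in C.
  move=> xy; apply: (connect_closed (P := fun z => z \in C) _ xy) => u v.
  case/orP=> [/eqP<-|/and3P[uC uD /eqP<-] _].
    by rewrite (matches_in _ mn0).
  exact: CD.
have [|p [mp lp]] := @exists_matching T _ (root R) D.
  move=> x xD; pose B := [set y | connect R x y].
  have sBC : B \subset C.
    by apply/subsetP => y; rewrite inE => /RC; apply; apply: DC.
  have -> : [set y in D | root R y == root R x] = D :&: B.
    by apply/setP => y; rewrite !inE (root_connect Rsym) Rsym.
  apply: even_part => //.
    move=> y /setDP[yB yD]; have yC := subsetP sBC _ yB; move: yB; rewrite !inE => xy.
    by apply: connect_trans xy (connect1 _); rewrite /R yC yD eqxx orbT.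
  apply: (even_closed (matchesK mn0)) => y yB.
    exact: (matches_neq mn0 (subsetP sBC _ yB)).
  move: yB; rewrite !inE => xy.
  by apply: connect_trans xy (connect1 _); rewrite /R eqxx.
have Rp x : connect R x (p x) by rewrite -(root_connect Rsym) lp.
pose f' x := if x \in C then x else if f x \in C then f (p (f x)) else f x.
have fxD x : x \notin C -> f x \in C -> f x \in D.
  by move=> xC fxC; rewrite inE fxC fK xC.
have mf' : matches (A :\: C) f'.
  split=> x; rewrite /f'; last first.
    rewrite inE; case: ifPn => [_|xC]; first by rewrite eqxx.
    case: ifPn => [fxC|fxC]; last by rewrite suppf.
    rewrite (can2_eq fK fK) (matches_neq mp (fxD _ xC fxC)).
    by rewrite -(matches_in x mf) (subsetP sCA).
  have [xC|xC] := boolP (x \in C); first by rewrite xC.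
  have [fxC|fxC] := boolP (f x \in C); last by rewrite (negPf fxC) fK (negPf xC).
  have pD : p (f x) \in D by rewrite (matches_in _ mp) fxD.
  have := pD; rewrite inE => /andP[pC fpC].
  by rewrite (negPf fpC) fK pC (matchesK mp) fK.
exists f'; split=> //.
  by move=> x xC fxC; rewrite /f' (negPf xC) (negPf fxC).
case=> n1 [mn1 En1 conn1]; pose n x := if x \in C then n0 x else n1 x.
have n1C x : (n1 x \in C) = (x \in C).
  have [xC|xC] := boolP (x \in C).
    by rewrite (matches_out mn1) // inE xC.
  have [xA|xA] := boolP (x \in A).
    have : n1 x \in A :\: C by rewrite (matches_in _ mn1) inE xC.
    by case/setDP=> _ /negPf.
  by rewrite (matches_out mn1) ?(negPf xC) // inE xC.
have mn : matches A n.
  split=> x; rewrite /n; last first.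
    case: ifPn => xC; first by rewrite (matches_neq mn0 xC) (subsetP sCA).
    by case: mn1 => _ ->; rewrite inE xC.
  have [xC|/negPf xC] := boolP (x \in C).
    by rewrite (matches_in _ mn0) xC (matchesK mn0).
  by rewrite n1C xC (matchesK mn1).
have sym := alt_sym fK (matchesK mn).
have RA x y : connect R x y -> connect (alt_rel f n) x y.
  apply: connect_sub => u v /orP[/eqP<-|/and3P[_ _ /eqP<-]]; last exact: alt1.
  have [uC|uC] := boolP (u \in C); last by rewrite (matches_out mn0).
  by apply: connect1; rewrite /alt_rel /n uC eqxx orbT.
have A'A x y : connect (alt_rel f' n1) x y -> connect (alt_rel f n) x y.
  apply: connect_sub => u v /orP[/eqP<-|/eqP<-]; last first.
    have [uC|uC] := boolP (u \in C); first by rewrite (matches_out mn1) // inE uC.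
    by apply: connect1; rewrite /alt_rel /n (negPf uC) eqxx orbT.
  rewrite /f'; case: ifP => // _; case: ifP => _; last exact: alt1.
  apply: connect_trans (alt1 _ _ _) (connect_trans (RA _ _ (Rp _)) (alt1 _ _ _)).
have toA' x : x \in A -> exists2 y, y \in A :\: C & connect (alt_rel f n) x y.
  move=> xA; have [xC|xC] := boolP (x \in C); last by exists x; rewrite // inE xC.
  have [/existsP[d /andP[dD xd]]|none] := boolP [exists d, (d \in D) && connect R x d].
    exists (f d); last exact: connect_trans (RA _ _ xd) (alt1 _ _ _).
    by have := dD; rewrite inE => /andP[dC fdC]; rewrite inE fdC (matches_in _ mf) (subsetP sCA).
  (* Without D in its component, x could not be linked to d0 by mc and n0. *)
  have noD d : connect R x d -> d \notin D.
    by move=> xd; apply: contra none => dD; apply/existsP; exists d; rewrite dD.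
  suff /noD : connect R x d0 by rewrite inE d0C fd0C.
  apply: (connect_closed (P := connect R x) _ (conn0 x d0 xC d0C) (connect0 _ _)); move=> u v uv xu.
  apply: (connect_trans xu (connect1 _)); move: uv; rewrite /alt_rel /mc /R.
  by rewrite (RC _ _ xu xC) (negPf (noD _ xu)) orbC.
exists n; split=> // [x xA|x y xA yA].
  by rewrite /n; case: ifPn => xC; [apply: En0 | apply: En1; rewrite inE xC].
have [x' x'A xx'] := toA' x xA; have [y' y'A yy'] := toA' y yA.
apply: connect_trans xx' _; rewrite sym; apply: connect_trans yy' _; rewrite sym.
exact/A'A/conn1.
Qed.

(** Induction on the number of classes, absorbing a class that is not a cut vertex
of the graph of classes: the edges of [f] between the other classes survive in
the reduced matching, so these stay linked. *)
Lemma gluing (T K : finType) (E : rel T) (k : T -> K) (S : {set K}) (f : T -> T) :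
  {in S, forall c, PHon E [set x | k x == c]} ->
  matches [set x | k x \in S] f ->
  {in S &, forall c d, connect (quot_rel k f) c d} ->
  exists n, completes E [set x | k x \in S] f n.
Proof.
have [m] := ubnP #|S|; elim: m S f => // m IH S f ltSm phS mf connS.
have fK := matchesK mf.
have [/card_le1_eqP S1|S_gt1] := leqP #|S| 1.
  have [S0|[c cS]] := set_0Vmem S.
    exists id; have A0 : [set x | k x \in S] = set0 by apply/setP => x; rewrite S0 !inE.
    by rewrite A0; split=> [|x|x y]; rewrite ?inE //; split=> // x; rewrite inE eqxx.
  have AE : [set x | k x \in S] = [set x | k x == c].
    by apply/setP => x; rewrite !inE; apply/idP/eqP => [xS|->//]; apply: S1.
  by move: mf; rewrite AE; case: (phS c cS) => _; apply.
have closS c d : quot_rel k f c d -> c \in S -> d \in S.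
  case/existsP=> x /andP[/eqP<- /eqP<-] kxS.
  by have := matches_in x mf; rewrite !inE kxS.
have [c cS conn'] := exists_noncut (quot_sym k fK) S_gt1 connS closS.
pose C := [set x | k x == c].
have AC : [set x | k x \in S] :\: C = [set x | k x \in S :\ c].
  by apply/setP => x; rewrite !inE.
have sCA : C \subset [set x | k x \in S].
  by apply/subsetP => x; rewrite !inE => /eqP->.
have crossC : exists2 d, d \in C & f d \notin C.
  have [d /setD1P[dc dS]] : exists d, d \in S :\ c.
    by apply/set0Pn; rewrite -card_gt0 -ltnS -add1n; move: S_gt1; rewrite (cardsD1 c) cS.
  case: (pickP [pred x | (x \in C) && (f x \notin C)]) => [x /andP[xC fxC]|none].
    by exists x.
  case/eqP: dc; apply: (connect_closed (P := fun z => z = c) _ (connS c d cS dS)) => //.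
  move=> _ b /existsP[x /andP[/eqP<- /eqP<-]] kx.
  by have := none x; rewrite /= !inE kx eqxx => /negbT; rewrite negbK => /eqP.
have [f' [mf' f'E complete']] := absorb_class (phS c cS) mf sCA crossC.
have [||||n1 comp1] := IH (S :\ c) f'.
- by move: ltSm; rewrite (cardsD1 c) cS add1n.
- by move=> d /setD1P[_]; apply: phS.
- by rewrite -AC.
- move=> a b aS bS; apply: connect_sub (conn' a b aS bS) => u v /and3P[uS vS].
  case/existsP=> x /andP[/eqP xu /eqP xv]; apply: connect1; subst u v.
  have [xC fxC] : x \notin C /\ f x \notin C.
    by split; rewrite inE; [case/setD1P: uS | case/setD1P: vS].
  by rewrite -(f'E x) //; apply: quot1.
by apply: complete'; exists n1; rewrite AC.
Qed.

(** * Prisms and products *)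

(** The product is given by abstract coordinates so that the two factors can be
exchanged: [mk] is the pairing map of either [G * H] or [H * G]. *)
Section Product.
Variables (G H T : finType) (mk : G -> H -> T) (p : T -> G) (q : T -> H).
Hypotheses (pK : forall g h, p (mk g h) = g) (qK : forall g h, q (mk g h) = h).
Hypothesis mkK : forall x, mk (p x) (q x) = x.
Variables (aG : rel G).

(** Adjacency of [G □ F] for a perfect matching [F] of [H] given as an involution. *)
Definition prism_rel (F : H -> H) : rel T := fun x y =>
  (q x == q y) && aG (p x) (p y) || (p x == p y) && (F (q x) == q y).

Lemma card_layer a : #|[set x | q x == a]| = #|G|.
Proof.
have <- : [set mk g a | g : G] = [set x | q x == a].
  apply/setP => x; rewrite inE; apply/imsetP/eqP => [[g _ ->]|<-]; first by rewrite qK.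
  by exists (p x); rewrite ?mkK.
by rewrite card_imset // => g g' /(congr1 p); rewrite !pK.
Qed.

Definition fiber (f : T -> T) (a : H) : G -> G := fun g => p (f (mk g a)).

Lemma mk_fiber f a g :
  q (f (mk g a)) = a -> mk (fiber f a g) a = f (mk g a).
Proof. by move=> qf; rewrite -[RHS]mkK qf. Qed.

Lemma fiber_matches A f a :
  matches A f -> [set x | q x == a] \subset A ->
  (forall g, q (f (mk g a)) = a) -> matches setT (fiber f a).
Proof.
move=> mf sA qf; split=> g; first by rewrite {1}/fiber mk_fiber // (matchesK mf) pK.
rewrite inE; have := matches_neq mf (x := mk g a); rewrite -mk_fiber // => neq.
apply: contraNneq (neq _) => [->//|]; by rewrite (subsetP sA) // inE qK.
Qed.

Hypothesis phG : PHon aG setT.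

Lemma layer_PH F a : PHon (prism_rel F) [set x | q x == a].
Proof.
case: phG => evG exG; split; first by rewrite card_layer -cardsT.
move=> f mf.
have qf g : q (f (mk g a)) = a.
  by have := matches_in (mk g a) mf; rewrite !inE qK eqxx => /eqP.
have [n1 [mn1 En1 conn1]] := exG _ (fiber_matches mf (subxx _) qf).
pose n x := if q x == a then mk (n1 (p x)) a else x.
have nmk g : n (mk g a) = mk (n1 g) a by rewrite /n qK pK eqxx.
exists n; split.
- split=> x; last rewrite inE.
    have [qx|qx] := eqVneq (q x) a; last by rewrite /n (negPf qx) (negPf qx).
    by rewrite -[x]mkK qx !nmk (matchesK mn1).
  have [qx|qx] := eqVneq (q x) a; last by rewrite /n (negPf qx) eqxx.
  rewrite -[x]mkK qx nmk; apply/eqP => /(congr1 p)/eqP; rewrite !pK.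
  by rewrite (negPf (matches_neq mn1 _)) // inE.
- move=> x; rewrite inE => /eqP qx; rewrite /prism_rel /n qx eqxx qK pK eqxx /=.
  by rewrite En1 // inE.
move=> x y; rewrite !inE => /eqP qx /eqP qy; rewrite -[x]mkK -[y]mkK qx qy.
apply: (connect_img (h := mk^~ a)); last by apply: conn1; rewrite inE.
move=> g g' /orP[/eqP<-|/eqP<-]; first by rewrite mk_fiber //; apply: alt1.
by rewrite -nmk; apply: alt2.
Qed.

(** In the alternating cycles of [f] and [n], delete at most one edge of [n] from
each; the ends [y] and [n y] remain connected. Otherwise the component [B] of [y]
would be closed under [f], hence even, while [B] minus [y] would be closed under
[n], hence even too. *)
Lemma swap_not_bridge (f n : G -> G) (X : {set G}) y :
  matches setT f -> matches setT n ->
  {in X, forall x, n x \in X} ->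
  {in X &, forall x z, connect (alt_rel f n) x z -> z = x \/ z = n x} ->
  connect (fun u v => (f u == v) || (u \notin X) && (n u == v)) y (n y).
Proof.
move=> mf mn nX X2; set r := (X in connect X).
have [yX|yX] := boolP (y \in X); last by apply: connect1; rewrite /r yX eqxx orbT.
apply: contraT => nyB.
pose B := [set z | connect r y z].
have r_alt u v : connect r u v -> connect (alt_rel f n) u v.
  by apply: connect_sub => a b /orP[/eqP<-|/andP[_ /eqP<-]]; [apply: alt1|apply: alt2].
have yB : y \in B by rewrite inE.
have evB : ~~ odd #|B|.
  apply: (even_closed (matchesK mf)) => z; first by rewrite (matches_neq mf) ?inE.
  rewrite !inE => yz; apply: (connect_trans yz (connect1 _)); by rewrite /r eqxx.
have : ~~ odd #|B :\ y|.
  apply: (even_closed (matchesK mn)) => z; first by rewrite (matches_neq mn) ?inE.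
  rewrite !inE => /andP[zy yz]; have zX : z \notin X.
    apply: contra_neqN zy => zX; case: (X2 y z yX zX (r_alt _ _ yz)) => // zE.
    by rewrite zE (negPf nyB) in yz.
  rewrite (can2_eq (matchesK mn) (matchesK mn)); apply/andP; split.
    by apply: contraNneq nyB => <-.
  by apply: (connect_trans yz (connect1 _)); rewrite /r zX eqxx orbT.
by move: evB; rewrite (cardsD1 y) yB /= negbK => ->.
Qed.

(** If [f] has an edge between the two layers, gluing applies. Otherwise complete
the matching of the first layer by [n1] and use the same [n1] in the second layer,
where it gives several alternating cycles with the second half of [f]. Choosing in
each of these cycles one edge of [n1] and replacing its two copies by the two
rungs at its ends merges everything into a single cycle. *)
Lemma prism_PH F a : matches setT F ->
  PHon (prism_rel F) [set x | q x \in [set a; F a]].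
Proof.
move=> mF; pose b := F a; pose S := [set a; b].
have FK := matchesK mF.
have ba : b != a by rewrite (matches_neq mF) ?inE.
have FS c : c \in S -> F c \in S.
  by case/set2P=> ->; rewrite /b ?FK !inE eqxx ?orbT.
have FN c : F c != c by rewrite (matches_neq mF) ?inE.
have sub c : c \in S -> [set x | q x == c] \subset [set x | q x \in S].
  by move=> cS; apply/subsetP => x; rewrite !inE => /eqP->; rewrite !inE in cS.
have aS : a \in S by rewrite !inE eqxx.
have bS : b \in S by rewrite !inE eqxx orbT.
split.
  have -> : [set x | q x \in S] = [set x | q x == a] :|: [set x | q x == b].
    by apply/setP => x; rewrite !inE.
  rewrite cardsU !card_layer (_ : _ :&: _ = set0) ?cards0 ?subn0 ?addnn ?odd_double //.
  by apply/setP => x; rewrite !inE; apply: contraNF ba => /andP[/eqP-> /eqP->].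
move=> f mf; have fK := matchesK mf.
case: (pickP [pred x | (q x == a) && (q (f x) == b)]) => [x /andP[/eqP qx /eqP qfx]|none].
  have rab : quot_rel q f a b by rewrite -{1}qx -qfx; apply: quot1.
  apply: gluing => // [c _|c d]; first exact: layer_PH.
  case/set2P=> -> /set2P[]-> //; apply: connect1 => //.
  by rewrite (quot_sym q fK).
have qf c g : c \in S -> q (f (mk g c)) = c.
  move=> cS; have := matches_in (mk g c) mf; rewrite !inE qK -!in_set2 cS.
  case/set2P: cS => -> /set2P[]// qf.
    by have := none (mk g a); rewrite /= qK qf !eqxx.
  by have := none (f (mk g b)); rewrite /= fK qK qf !eqxx.
have mfib c : c \in S -> matches setT (fiber f c).
  by move=> cS; apply: (fiber_matches mf (sub c cS)) => g; apply: qf.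
have [_ exG] := phG; have [n1 [mn1 En1 conn1]] := exG _ (mfib a aS).
have n1K := matchesK mn1; have mf2 := mfib b bS.
pose r2 := alt_rel (fiber f b) n1.
have r2sym : connect_sym r2 by apply: alt_sym => //; apply: matchesK mf2.
(* The ends of one edge of n1 in each alternating cycle of the second layer *)
pose X := [set g | (g == root r2 g) || (n1 g == root r2 g)].
have rootn g : root r2 (n1 g) = root r2 g.
  by apply/esym/eqP; rewrite (root_connect r2sym); apply: alt2.
have nX g : (n1 g \in X) = (g \in X) by rewrite !inE rootn n1K orbC.
have rootX g : root r2 g \in X by rewrite inE (root_root r2sym) eqxx.
have X2 : {in X &, forall x z, connect r2 x z -> z = x \/ z = n1 x}.
  move=> x z; rewrite !inE -(root_connect r2sym) => xX zX /eqP xz.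
  rewrite -xz in zX; case/orP: xX => /eqP xE; case/orP: zX => /eqP zE.
  - by left; rewrite zE -xE.
  - by right; rewrite -[z]n1K zE -xE.
  - by right; rewrite zE -xE.
  by left; apply: (inv_inj n1K); rewrite zE -xE.
have bridge y : connect (fun u v => (fiber f b u == v) || (u \notin X) && (n1 u == v)) y (n1 y).
  by apply: swap_not_bridge => // x xX; rewrite nX.
pose n x := if q x \in S then
  if p x \in X then mk (p x) (F (q x)) else mk (n1 (p x)) (q x) else x.
have nout g c : c \in S -> g \notin X -> n (mk g c) = mk (n1 g) c.
  by move=> cS gX; rewrite /n qK pK cS (negPf gX).
have nin g c : c \in S -> g \in X -> n (mk g c) = mk g (F c).
  by move=> cS gX; rewrite /n qK pK cS gX.
have mn : matches [set x | q x \in S] n.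
  split=> x; last rewrite inE.
    rewrite -[x]mkK; have [qS|/negPf qS] := boolP (q x \in S).
      have [pX|pX] := boolP (p x \in X).
        by rewrite (nin _ _ qS pX) nin ?FS // FK.
      by rewrite (nout _ _ qS pX) nout ?nX // n1K.
    by rewrite /n qK qS qK qS.
  have [qS|/negPf qS] := boolP (q x \in S); last by rewrite /n qS eqxx.
  rewrite -{1 2}[x]mkK; apply/eqP.
  have [pX|pX] := boolP (p x \in X).
    by rewrite nin // => /(congr1 q)/eqP; rewrite !qK (negPf (FN _)).
  rewrite nout // => /(congr1 p)/eqP; rewrite !pK.
  by rewrite (negPf (matches_neq mn1 _)) ?inE.
exists n; split=> //.
- move=> x; rewrite inE => qS; rewrite -[x]mkK /prism_rel.
  have [pX|pX] := boolP (p x \in X).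
    by rewrite nin // !pK !qK !eqxx orbT.
  by rewrite nout // !pK !qK eqxx En1 // inE.
set r := alt_rel f n; have rsym : connect_sym r := alt_sym fK (matchesK mn).
have rung g : g \in X -> connect r (mk g a) (mk g b).
  by move=> gX; rewrite -(nin g a) //; apply: alt2.
have edgeb g g' : (fiber f b g == g') || (g \notin X) && (n1 g == g') ->
    connect r (mk g b) (mk g' b).
  case/orP=> [/eqP<-|/andP[gX /eqP<-]]; first by rewrite mk_fiber ?qf //; apply: alt1.
  by rewrite -nout //; apply: alt2.
have layerb g g' : connect r2 g g' -> connect r (mk g b) (mk g' b).
  apply: (connect_img (h := mk^~ b)) => u v /orP[uv|/eqP<-].
    by apply: edgeb; rewrite uv.
  exact: (connect_img (h := mk^~ b) edgeb).
have layera g g' : connect r (mk g a) (mk g' a).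
  apply: (connect_img (h := mk^~ a) _ (conn1 g g' _ _)); rewrite ?inE // => u v.
  case/orP=> [/eqP<-|/eqP<-]; first by rewrite mk_fiber ?qf //; apply: alt1.
  have [uX|uX] := boolP (u \in X); last by rewrite -nout //; apply: alt2.
  apply: (connect_trans (rung u uX)); rewrite rsym.
  have nuX : n1 u \in X by rewrite nX.
  apply: (connect_trans (rung _ nuX)); rewrite rsym.
  exact/layerb/alt2.
have toa g c : c \in S -> connect r (mk g c) (mk g a).
  case/set2P=> -> //; pose g0 := root r2 g.
  apply: (connect_trans (layerb g g0 (connect_root _ _))).
  rewrite rsym; apply: (connect_trans (layera g g0)); exact: rung (rootX g).
move=> x y; rewrite 2!in_set => xS yS; rewrite -[x]mkK -[y]mkK.
apply: (connect_trans (toa _ _ xS)); rewrite rsym.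
by apply: (connect_trans (toa _ _ yS)); apply: layera.
Qed.

(** The classes to be glued are the prisms [cls h]; they are linked by [f] because
[F] completes a matching [e] that pairs [h] only with elements linked to it. *)
Lemma product_completion (aH : rel H) f :
  PHon aH setT -> matches setT f ->
  (forall h, ~~ odd #|[set h' | root (quot_rel q f) h' == root (quot_rel q f) h]|) ->
  exists F n, [/\ matches setT F, forall h, aH h (F h)
    & completes (prism_rel F) setT f n].
Proof.
move=> [_ exH] mf ev; have fK := matchesK mf.
set r := quot_rel q f in ev; have rsym : connect_sym r := sym_connect_sym (quot_sym q fK).
have [|e [me re]] := @exists_matching H _ (root r) setT.
  move=> h _; congr (~~ odd #|pred_of_set _|): (ev h).
  by apply/setP => h'; rewrite !inE.
have [F [mF adjF connF]] := exH e me; have FK := matchesK mF.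
pose cls h := [set h; F h]; pose k x := cls (q x).
have clsF h : cls (F h) = cls h by rewrite /cls FK setUC.
have clsE h a : (cls h == cls a) = (h \in cls a).
  apply/eqP/idP => [<-|/set2P[]-> //]; by rewrite !inE eqxx.
pose S := [set cls h | h : H].
have AT : [set x | k x \in S] = setT by apply/setP => x; rewrite [RHS]inE inE; apply: imset_f.
have [|||n comp] := @gluing T {set H} (prism_rel F) k S f.
- move=> _ /imsetP[a _ ->]; have -> : [set x | k x == cls a] = [set x | q x \in cls a].
    by apply/setP => x; rewrite !inE clsE !inE.
  exact: prism_PH.
- by rewrite AT.
- move=> _ _ /imsetP[h _ ->] /imsetP[h' _ ->].
  apply: (connect_img (h := cls) _ (connF h h' _ _)); rewrite ?inE // => u v.
  case/orP=> /eqP<-; last by rewrite clsF.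
  have: connect r u (e u) by rewrite -(root_connect rsym) re.
  apply: (connect_img (h := cls)) => _ _ /existsP[x /andP[/eqP<- /eqP<-]].
  by apply: connect1; apply: (quot1 k).
by rewrite AT in comp; exists F, n; split=> // h; apply: adjF; rewrite inE.
Qed.

(** The product of a class of [G] and a class of [H] is closed under [f]. *)
Lemma even_block f g h : matches setT f ->
  ~~ odd (#|[set g' | root (quot_rel p f) g' == root (quot_rel p f) g]|
          * #|[set h' | root (quot_rel q f) h' == root (quot_rel q f) h]|).
Proof.
move=> mf; have fK := matchesK mf.
set A := (X in #|pred_of_set X| * _); set B := (X in _ * #|pred_of_set X|).
have <- : #|[set mk u.1 u.2 | u in setX A B]| = #|A| * #|B|.
  rewrite card_imset ?cardsX // => -[a b] [a' b'] /= e.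
  by rewrite -(pK a b) -{2}(qK a b) e pK qK.
have -> : [set mk u.1 u.2 | u in setX A B] = [set x | (p x \in A) && (q x \in B)].
  apply/setP => x; rewrite inE; apply/imsetP/idP => [[u + ->]|xAB].
    by rewrite pK qK inE.
  by exists (p x, q x); [rewrite in_setX | rewrite /= mkK].
have rootf (K : finType) (k : T -> K) x :
    root (quot_rel k f) (k (f x)) = root (quot_rel k f) (k x).
  apply/esym/eqP; rewrite (root_connect (sym_connect_sym (quot_sym k fK))).
  exact/connect1/quot1.
apply: (even_closed fK) => x; first by rewrite (matches_neq mf) ?inE.
by rewrite !inE !rootf.
Qed.

End Product.

(** * Copies of a pairing in all layers *)

Section Converse.
Variables (G H T : finType) (mk : G -> H -> T) (p : T -> G) (q : T -> H).
Hypotheses (pK : forall g h, p (mk g h) = g) (qK : forall g h, q (mk g h) = h).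
Hypothesis mkK : forall x, mk (p x) (q x) = x.

Definition lift (f : G -> G) : T -> T := fun x => mk (f (p x)) (q x).

Lemma lift_matches f : matches setT f -> matches setT (lift f).
Proof.
move=> mf; split=> x; first by rewrite /lift pK qK (matchesK mf) mkK.
rewrite inE; apply/eqP => /(congr1 p)/eqP; rewrite pK.
by rewrite (negPf (matches_neq mf _)) ?inE.
Qed.

(** With edges of [n] that change the second coordinate only along [F], the set
[{h, F h}] of second coordinates could not be left. *)
Lemma lift_not_vertical f n F : 2 < #|H| -> 0 < #|G| -> involutive F ->
  (forall x y, connect (alt_rel (lift f) n) x y) ->
  ~ forall x, q (n x) = q x \/ q (n x) = F (q x).
Proof.
move=> H_gt2 /card_gt0P[g _] FK conn qn.
have /card_gt0P[h _] : 0 < #|H| by apply: leq_trans H_gt2.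
suff : #|H| <= #|[set h; F h]|.
  by move=> /(leq_trans H_gt2); rewrite cards2; case: eqP.
rewrite subset_leq_card //; apply/subsetP => h' _.
rewrite -(qK g h').
apply: (connect_closed (P := fun x => q x \in [set h; F h]) _
  (conn (mk g h) (mk g h'))); last by rewrite qK !inE eqxx.
move=> u v /orP[/eqP<-|/eqP<-]; first by rewrite /lift qK.
case: (qn u) => -> //; by case/set2P=> ->; rewrite ?FK !inE eqxx ?orbT.
Qed.

Lemma lift_horizontal f n F : 0 < #|H| ->
  (forall x y, connect (alt_rel (lift f) n) x y) ->
  (forall x, p (n x) = p x \/ p (n x) = F (p x)) ->
  forall g g', connect (alt_rel f F) g g'.
Proof.
move=> /card_gt0P[h _] conn pn g g'; rewrite -(pK g h) -(pK g' h).
apply: (connect_img (h := p)) (conn _ _) => u v /orP[/eqP<-|/eqP<-].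
  by rewrite /lift pK; apply: alt1.
by case: (pn u) => ->; [apply: connect0 | apply: alt2].
Qed.

End Converse.

(** * Perfect matchings and Hamiltonian cycles as edge sets *)

Definition mset (T : finType) (f : T -> T) : {set {set T}} :=
  [set [set x; f x] | x : T].


Lemma mem_edges (G : sgraph) (x y : G) : ([set x; y] \in edges G) = adj x y.
Proof.
apply/imset2P/idP => [[u v _]|xy]; last by exists x y; rewrite ?inE.
rewrite inE => /andP[_ uv] e.
have uvN : u != v by apply: contraTneq uv => ->; rewrite adj_irr.
have xyN : x != y.
  by have := congr1 (fun A : {set G} => #|A|) e; rewrite !cards2 uvN; case: eqP.
have := set21 x y; have := set22 x y; rewrite e.
case/set2P=> yE /set2P[] xE; rewrite xE yE ?eqxx // in xyN *.
by rewrite adj_sym.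
Qed.

Lemma mem_mset (T : finType) (f : T -> T) x y :
  matches setT f -> ([set x; y] \in mset f) = (f x == y).
Proof.
move=> mf; apply/imsetP/eqP => [[z _ e]|<-]; last by exists x.
have zN : z != f z by rewrite eq_sym (matches_neq mf) ?inE.
have xyN : x != y.
  by have := congr1 (fun A : {set T} => #|A|) e; rewrite !cards2 zN; case: eqP.
have := set21 x y; have := set22 x y; rewrite e.
case/set2P=> yE /set2P[] xE; rewrite xE yE ?eqxx // in xyN *.
by rewrite (matchesK mf).
Qed.

Lemma mset_sub_edges (G : sgraph) (f : G -> G) :
  mset f \subset edges G <-> forall x, adj x (f x).
Proof.
split=> [/subsetP sub x|adjf]; first by rewrite -mem_edges; apply/sub/imset_f.
by apply/subsetP => _ /imsetP[x _ ->]; rewrite mem_edges.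
Qed.

Lemma mset_perfect (G : sgraph) (f : G -> G) :
  matches setT f -> (forall x, adj x (f x)) -> perfect_matching (mset f).
Proof.
move=> mf adjf; have fK := matchesK mf; split.
  exact/mset_sub_edges.
have pairE x z : z \in [set x; f x] -> [set x; f x] = [set z; f z].
  by case/set2P=> ->; rewrite ?fK // setUC.
apply/and3P; split.
- rewrite eqEsubset subsetT; apply/subsetP => x _.
  by apply/bigcupP; exists [set x; f x]; rewrite ?set21 ?(mem_mset _ _ mf).
- apply/trivIsetP => _ _ /imsetP[x _ ->] /imsetP[y _ ->]; apply: contraR.
  by case/pred0Pn=> z /andP[/= /pairE-> /pairE->].
by apply/imsetP => -[x _ /setP/(_ x)]; rewrite !inE eqxx.
Qed.

Lemma perfect_mset (G : sgraph) (F : {set {set G}}) : perfect_matching F ->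
  exists f, [/\ matches setT f, forall x, adj x (f x) & F = mset f].
Proof.
case=> sFE /and3P[/eqP covF tiF _].
have edgeF B x : B \in F -> x \in B -> exists2 y, adj x y & B = [set x; y].
  move/(subsetP sFE)/imset2P=> [u v _]; rewrite inE => /andP[_ uv ->].
  by case/set2P=> ->; [exists v | exists u; rewrite // 1?adj_sym // setUC].
have mate x : exists y, adj x y && ([set x; y] \in F).
  have : x \in cover F by rewrite covF inE.
  by case/bigcupP=> B BF /(edgeF _ _ BF)[y xy BE]; exists y; rewrite xy -BE.
have [f fP] := fin_all_exists mate.
have fadj x : adj x (f x) by case/andP: (fP x).
have fF x : [set x; f x] \in F by case/andP: (fP x).
have fN x : f x != x by apply: contraTneq (fadj x) => ->; rewrite adj_irr.
have uniqF B x : B \in F -> x \in B -> B = [set x; f x].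
  by move=> BF xB; rewrite -(def_pblock tiF BF xB) (def_pblock tiF (fF x)) ?set21.
have mf : matches setT f.
  split=> x; last by rewrite inE fN.
  have /setP/(_ (f (f x))) := uniqF _ (f x) (fF x) (set22 _ _).
  by rewrite set22 => /set2P[]// /eqP; rewrite (negPf (fN _)).
exists f; split=> //; apply/setP => B; apply/idP/imsetP => [BF|[x _ ->]//].
have /set0Pn[x xB] : B != set0.
  by have /imset2P[u v _ _ ->] := subsetP sFE _ BF; apply/set0Pn; exists u; rewrite set21.
by exists x => //; apply: uniqF.
Qed.

(** * Connected pairs of matchings are Hamiltonian *)

Section Tour.
Variables (T : finType) (f n : T -> T).
Hypotheses (mf : matches setT f) (mn : matches setT n).
Hypothesis conn : forall x y, connect (alt_rel f n) x y.
Let fK := matchesK mf.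
Let nK := matchesK mn.
Let h := n \o f.

Lemma two_step_inj : injective h.
Proof. by apply: inj_comp; apply: inv_inj. Qed.

(** The cycles of [n \o f] are bipartite: [f y] is never reached from [y] in steps
of two edges. Indeed [h ^ k y = f y] implies [h ^ (k - 2) (h y) = f (h y)],
which ends in a fixed point of [f] or of [n]. *)
Lemma two_step_neq k y : iter k h y != f y.
Proof.
have [m] := ubnP k; elim: m k y => // m IH [|[|k]] y ltkm.
- by rewrite /= eq_sym (matches_neq mf) ?inE.
- by rewrite /= (matches_neq mn) ?inE.
apply: contraNneq (IH k (h y) _) => [e|]; last by rewrite ltnW // ltnW.
apply/eqP/two_step_inj; rewrite -iterS -iterSr e /h /=.
by rewrite fK nK.
Qed.

(** The orbit [O] of [x0] under [n \o f] is one side of the alternating cycle and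
[f] maps it to the other side, so following [f] on [O] and [n] off [O] traverses
the cycle in one direction. *)
Lemma alternating_tour x0 : exists s : T -> T,
  [/\ injective s, forall x, s x != x, forall x, fconnect s x0 x
    & mset f :|: mset n = [set [set x; s x] | x : T]].
Proof.
pose O x := fconnect h x0 x; pose s x := if O x then f x else n x.
have hsym := fconnect_sym two_step_inj.
have Oh x : O x -> O (h x).
  by move=> Ox; apply: (connect_trans Ox); apply: fconnect1.
have Ofn x : O x -> O (f (n x)).
  move=> Ox; apply: (connect_trans Ox); rewrite hsym.
  by apply: connect1; rewrite /= /h /= fK nK.
have Of x : O x -> ~~ O (f x).
  move=> Ox; apply/negP => Ofx.
  have : fconnect h x (f x).
    by apply: connect_trans Ofx; rewrite hsym.
  by case/iter_findex/eqP; rewrite (negPf (two_step_neq _ _)).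
have nO x : ~~ O x -> O (f x).
  have : O x || O (f x).
    apply: (connect_closed (P := fun x => O x || O (f x)) _ (conn x0 x)).
      move=> u v /orP[/eqP<-|/eqP<-]; first by rewrite fK orbC.
      case/orP=> [/Ofn->|/Oh]; first by rewrite orbT.
      by rewrite /h /= fK => ->.
    by rewrite /O connect0.
  by case/orP=> // ->.
have On x : O x -> ~~ O (n x).
  by move/Ofn/Of; rewrite fK.
have nOn x : ~~ O x -> O (n x).
  by move/nO/Oh; rewrite /h /= fK.
have sO x : O x -> s x = f x by rewrite /s => ->.
have sN x : ~~ O x -> s x = n x by rewrite /s => /negPf->.
have sNeg x : O (s x) = ~~ O x.
  have [Ox|nOx] := boolP (O x); first by rewrite sO // (negPf (Of _ Ox)).
  by rewrite sN // nOn.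
have sfx x : ~~ O x -> s (f x) = x by move/nO/sO; rewrite fK.
have snx x : O x -> s (n x) = x by move/On/sN; rewrite nK.
have covO x : O x -> fconnect s x0 x.
  move=> Ox; suff /andP[] : O x && fconnect s x0 x by [].
  apply: (connect_closed (P := fun x => O x && fconnect s x0 x) _ Ox); last first.
    by rewrite /O !connect0.
  move=> u v /eqP<- /andP[Ou su]; rewrite Oh //=.
  have -> : h u = s (s u) by rewrite (sO u) // sN // Of.
  by apply: (connect_trans su); apply: (fconnect_iter s 2).
exists s; split.
- move=> x y sxy; have := congr1 O sxy; rewrite !sNeg => /(congr1 negb); rewrite !negbK.
  have [Ox|nOx] := boolP (O x) => Oy; move: sxy.
    by rewrite !sO // => /(inv_inj fK).
  by rewrite !sN -?Oy // => /(inv_inj nK).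
- by move=> x; apply/eqP => /(congr1 O); rewrite sNeg; case: (O x).
- move=> x; have [/covO//|nOx] := boolP (O x).
  by apply: (connect_trans (covO _ (nO _ nOx))); rewrite -{2}(sfx x) //; apply: fconnect1.
apply/setP => B; apply/setUP/imsetP => [[]/imsetP[x _ ->]|[x _ ->]].
- have [Ox|nOx] := boolP (O x); first by exists x; rewrite ?sO.
  by exists (f x); rewrite ?sfx // setUC.
- have [Ox|nOx] := boolP (O x); last by exists x; rewrite ?sN.
  by exists (n x); rewrite ?snx // setUC.
by rewrite /s; case: ifP => _; [left|right]; apply: imset_f.
Qed.

End Tour.

Lemma connect_hamiltonian (T : finType) (f n : T -> T) :
  2 < #|T| -> matches setT f -> matches setT n ->
  (forall x y, connect (alt_rel f n) x y) ->
  [disjoint mset f & mset n] /\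
  @hamiltonian_cycle (complete T) (mset f :|: mset n).
Proof.
move=> T_gt2 mf mn conn; split.
  apply/pred0Pn => -[_ /andP[/= /imsetP[x _ ->]]]; rewrite mem_mset // => /eqP nx.
  suff : #|T| <= #|[set x; f x]|.
    by move=> /(leq_trans T_gt2); rewrite cards2; case: eqP.
  rewrite subset_leq_card //; apply/subsetP => y _.
  apply: (connect_closed (P := fun y => y \in [set x; f x]) _ (conn x y)); last exact: set21.
  move=> u v /orP[/eqP<-|/eqP<-] /set2P[]->; rewrite ?(matchesK mf) -?nx ?(matchesK mn);
    by rewrite ?set21 ?set22 // nx set22.
have /card_gt0P[x0 _] : 0 < #|T| by apply: leq_trans T_gt2.
have [s [s_inj sN cov sE]] := alternating_tour mf mn conn x0.
have allc x : x \in orbit s x0 by rewrite -fconnect_orbit.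
have cyc := cycle_orbit s_inj x0.
exists (orbit s x0); split=> //.
- have -> : size (orbit s x0) = #|T|; last exact: T_gt2.
  by rewrite -(card_uniqP (orbit_uniq s x0)); apply: eq_card => x; apply: allc.
- rewrite /ucycle orbit_uniq andbT; apply: sub_cycle cyc => x y /eqP<-.
  by rewrite /= eq_sym.
rewrite sE; apply: eq_imset => x.
by have /eqP-> := next_cycle cyc (allc x).
Qed.

Lemma hamiltonian_connect (T : finType) (f n : T -> T) :
  matches setT f -> matches setT n ->
  @hamiltonian_cycle (complete T) (mset f :|: mset n) ->
  forall x y, connect (alt_rel f n) x y.
Proof.
move=> mf mn [c [_ /andP[_ Uc] allc cE]] x y.
have : fconnect (next c) x y by rewrite (fconnect_cycle (cycle_next Uc)).
apply: connect_sub => u v /eqP<-; apply: connect1.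
have : [set u; next c u] \in mset f :|: mset n by rewrite cE; apply/imsetP; exists u.
by rewrite inE !mem_mset.
Qed.

Lemma hamiltonian_completionP (G : sgraph) (f : G -> G) (N : {set {set G}}) :
  2 < #|G| -> matches setT f ->
  hamiltonian_completion (mset f) N <->
  exists2 n, N = mset n & completes (@adj G) setT f n.
Proof.
move=> G_gt2 mf; split=> [[pN _ hc]|[n -> [mn adjn conn]]].
  have [n [mn adjn NE]] := perfect_mset pN; exists n => //; split=> // x y _ _.
  by apply: hamiltonian_connect; rewrite -?NE.
have adjn' x : adj x (n x) by apply: adjn; rewrite inE.
have [|d hc] := connect_hamiltonian G_gt2 mf mn; first by move=> x y; apply: conn; rewrite inE.
by split=> //; apply: mset_perfect.
Qed.

Lemma pairing_mset (G : sgraph) (M : {set {set G}}) :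
  pairing M <-> exists2 f, M = mset f & matches setT f.
Proof.
split=> [/perfect_mset[f [mf _ ->]]|[f -> mf]]; first by exists f.
apply: (@mset_perfect (complete G)) => // x.
by rewrite /= eq_sym (matches_neq mf) ?inE.
Qed.

Lemma PH_PHon (G : sgraph) : ~~ odd #|G| -> 4 <= #|G| ->
  PH G <-> PHon (@adj G) setT.
Proof.
move=> evG leG; have G_gt2 : 2 < #|G| by apply: leq_trans leG.
split=> [[_ _ compG]|[_ exG]].
  split; first by rewrite cardsT.
  move=> f mf; have [|N /hamiltonian_completionP[]//] := compG (mset f).
    by apply/pairing_mset; exists f.
  by move=> n _ cn; exists n.
split=> // M /pairing_mset[f -> mf]; have [n cn] := exG f mf.
by exists (mset n); apply/hamiltonian_completionP => //; exists n.
Qed.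


(** * The equivalence *)

Section Assembly.
Variables G H : sgraph.
Hypotheses (evenG : ~~ odd #|G|) (leG : 4 <= #|G|).
Hypotheses (evenH : ~~ odd #|H|) (leH : 4 <= #|H|).

Lemma card_cart_gt2 : 2 < #|cart G H|.
Proof.
rewrite card_prod; apply: leq_trans (leq_pmulr _ _); first exact: leq_trans leG.
exact: leq_trans leH.
Qed.

Lemma PH_prismatic (M : {set {set cart G H}}) : PH G -> PH H -> pairing M ->
  exists N, hamiltonian_completion M N /\ prismatic_support N.
Proof.
move=> /(PH_PHon evenG leG) phG /(PH_PHon evenH leH) phH /pairing_mset[f -> mf].
have pairK (x : G * H) : (x.1, x.2) = x by case: x.
pose cls (K : finType) (k : G * H -> K) c := [set d | root (quot_rel k f) d == root (quot_rel k f) c].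
have even_blocks g h : ~~ odd (#|cls _ fst g| * #|cls _ snd h|).
  exact: (even_block (mk := pair) (p := fst) (q := snd)).
(* An odd class in H forces all the classes in G to be even. *)
have [evH|/forallPn[h oddh]] := boolP [forall h, ~~ odd #|cls _ snd h|].
  have [F [n [mF adjF [mn En cn]]]] :=
    @product_completion G H _ pair fst snd (fun=> fun=> erefl) (fun=> fun=> erefl)
      pairK _ phG _ f phH mf (fun h => forallP evH h).
  exists (mset n); split.
    apply/(hamiltonian_completionP _ card_cart_gt2 mf); exists n => //.
    split=> // x xT; have := En x xT; rewrite /prism_rel /= /cart_adj.
    case/orP=> /andP[/eqP e]; first by rewrite e eqxx => ->; rewrite orbT.
    by move/eqP=> <-; rewrite e eqxx adjF.
  right; exists (mset F); first exact: mset_perfect.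
  apply/(@mset_sub_edges (cart G (spanning (mset F)))) => x.
  have := En x (in_setT x); rewrite /prism_rel /= /cart_adj /= /spanning_adj mem_mset //.
  case/orP=> /andP[/eqP-> xn]; first by rewrite eqxx xn orbT.
  rewrite eqxx /= -(eqP xn) eq_sym (matches_neq mF) ?inE //; by rewrite eqxx.
have evG g : ~~ odd #|cls _ fst g|.
  by have := even_blocks g h; rewrite oddM negb_and (negPf oddh) orbF.
have [F [n [mF adjF [mn En cn]]]] :=
  @product_completion H G _ (fun h g => (g, h)) snd fst (fun=> fun=> erefl) (fun=> fun=> erefl)
    pairK _ phH _ f phG mf evG.
exists (mset n); split.
  apply/(hamiltonian_completionP _ card_cart_gt2 mf); exists n => //.
  split=> // x xT; have := En x xT; rewrite /prism_rel /= /cart_adj.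
  case/orP=> /andP[/eqP e]; first by rewrite e eqxx => ->.
  by move/eqP=> <-; rewrite e eqxx adjF orbT.
left; exists (mset F); first exact: mset_perfect.
apply/(@mset_sub_edges (cart (spanning (mset F)) H)) => x.
have := En x (in_setT x); rewrite /prism_rel /= /cart_adj /= /spanning_adj mem_mset //.
case/orP=> /andP[/eqP-> xn]; first by rewrite eqxx xn.
rewrite eqxx /= -(eqP xn) eq_sym (matches_neq mF) ?inE // eqxx; by rewrite orbT.
Qed.

Lemma prismatic_support_mates (n : G * H -> G * H) :
  prismatic_support (G := G) (H := H) (mset n) ->
  (exists F : G -> G, [/\ matches setT F, forall g, adj g (F g)
     & forall x, (n x).1 = x.1 \/ (n x).1 = F x.1]) \/
  (exists F : H -> H, [/\ matches setT F, forall h, adj h (F h)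
     & forall x, (n x).2 = x.2 \/ (n x).2 = F x.2]).
Proof.
case=> -[F0 /perfect_mset[F [mF adjF ->]]].
  move/(@mset_sub_edges (cart (spanning (mset F)) H)) => sN.
  left; exists F; split=> // x; have := sN x.
  rewrite /= /cart_adj /= /spanning_adj mem_mset //.
  by case/orP=> [/andP[/eqP-> _]|/and3P[_ _ /eqP->]]; [left|right].
move/(@mset_sub_edges (cart G (spanning (mset F)))) => sN.
right; exists F; split=> // x; have := sN x.
rewrite /= /cart_adj /= /spanning_adj mem_mset //.
by case/orP=> [/and3P[_ _ /eqP->]|/andP[/eqP-> _]]; [right|left].
Qed.

Lemma prismatic_PH :
  (forall M : {set {set cart G H}}, pairing M ->
     exists N, hamiltonian_completion M N /\ prismatic_support N) ->
  PH G /\ PH H.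
Proof.
move=> comp.
have pairK (x : G * H) : (x.1, x.2) = x by case: x.
have [G_gt2 H_gt2] : 2 < #|G| /\ 2 < #|H| by split; [apply: leq_trans leG|apply: leq_trans leH].
have [G_gt0 H_gt0] : 0 < #|G| /\ 0 < #|H| by split; apply: leq_trans (_ : _ <= 3) _.
have tour (f : G * H -> G * H) : matches setT f -> exists n : G * H -> G * H,
    (forall x y, connect (alt_rel f n) x y) /\ prismatic_support (G := G) (H := H) (mset n).
  move=> mf; have [|N [+ supp]] := comp (mset f).
    by apply/(@pairing_mset (cart G H)); exists f.
  case/(hamiltonian_completionP _ card_cart_gt2 mf)=> n NE [_ _ cn].
  by exists n; rewrite -NE; split=> // x y; apply: cn; rewrite inE.
split.
  apply/(PH_PHon evenG leG); split; first by rewrite cardsT.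
  move=> f mf.
  have [|n [cn /prismatic_support_mates supp]] := tour (lift pair fst snd f).
    exact: lift_matches.
  case: supp => -[F [mF adjF nF]].
    exists F; split=> // x y _ _.
    exact: (lift_horizontal (mk := pair) (p := fst) (q := snd)) H_gt0 cn nF x y.
  case: (lift_not_vertical (mk := pair) (p := fst) (q := snd) _ H_gt2 G_gt0 (matchesK mF) cn nF) => //.
apply/(PH_PHon evenH leH); split; first by rewrite cardsT.
move=> f mf.
have [|n [cn /prismatic_support_mates supp]] := tour (lift (fun h g => (g, h)) snd fst f).
  exact: lift_matches.
case: supp => -[F [mF adjF nF]].
  case: (lift_not_vertical (mk := fun h g => (g, h)) (p := snd) (q := fst) _ G_gt2 H_gt0 (matchesK mF) cn nF) => //.
exists F; split=> // x y _ _.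
exact: (lift_horizontal (mk := fun h g => (g, h)) (p := snd) (q := fst)) G_gt0 cn nF x y.
Qed.

End Assembly.

Theorem theorem3p4 (G H : sgraph)
  (evenG : ~~ odd #|G|) (leG : 4 <= #|G|)
  (evenH : ~~ odd #|H|) (leH : 4 <= #|H|) :
  (PH G /\ PH H) <->
  (forall M : {set {set cart G H}}, pairing M ->
     exists N : {set {set cart G H}},
       hamiltonian_completion M N /\ prismatic_support N).
Proof.
split=> [[phG phH] M|]; first exact: PH_prismatic.
exact: prismatic_PH.
Qed.
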